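(* Let $\tau>0$, $\mu>0$, $c,r,d\in\mathbb{R}$, $T>0$, $a,b>0$, and consider the neutral partial differential equation $$\partial_tu(x,t)=\mu^2\partial_{xx}u(x,t)+\mu^2c^2\partial_{xx}u(x,t-\tau)+r\,u(x,t)+d\,u(x,t-\tau)$$ on the spatial interval $(-a,b)$ with prescribed history function on $[-a,b]\times[-\tau,0]$ and homogeneous Dirichlet boundary conditions at $x=-a$ and $x=b$. Consider the Neumann-Neumann waveform relaxation (NNWR) error iteration with relaxation parameter $\theta$ for this problem on the two subdomains $\Omega_1=(-a,0)$ and $\Omega_2=(0,b)$, started from an admissible initial interface error $g^0$. Suppose the subdomains are of equal size, i.e. $a=b$. Then: (i) for $0<\theta<1/2$, $\theta\neq 1/4$, the NNWR iteration converges linearly; (ii) for $\theta=1/4$, the NNWR iteration converges in two iterations, for every time window length $T>0$.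
   Context: NNWR error iteration. Since the problem is linear, the iteration is written for the error, i.e. with zero history and zero boundary data. Given $g^0:[0,T]\to\mathbb{R}$ (initial error on the interface $\{x=0\}$), for $k=1,2,\dots$ and $i=1,2$ let $e_i^k$ solve the Dirichlet problem $$\partial_te_i^k-\mu^2\partial_{xx}e_i^k-\mu^2c^2\partial_{xx}e_i^k(x,t-\tau)-r e_i^k(x,t)-d e_i^k(x,t-\tau)=0\text{ in }\Omega_i\times(0,T),$$ $$e_i^k=0\text{ on }\Omega_i\times[-\tau,0],\quad e_i^k(0,t)=g^{k-1}(t),\ t\in(0,T),$$ with $e_1^k(-a,t)=0$ and $e_2^k(b,t)=0$; then let $\phi_i^k$ solve the Neumann problem $$\partial_t\phi_i^k-\mu^2\partial_{xx}\phi_i^k-\mu^2c^2\partial_{xx}\phi_i^k(x,t-\tau)-r \phi_i^k(x,t)-d \phi_i^k(x,t-\tau)=0\text{ in }\Omega_i\times(0,T),$$ $$\phi_i^k=0\text{ on }\Omega_i\times[-\tau,0],\quad \phi_1^k(-a,t)=0,\quad \phi_2^k(b,t)=0,$$ $$\partial_x\phi_1^k(0,t)=\partial_xe_1^k(0,t)-\partial_xe_2^k(0,t),\qquad -\partial_x\phi_2^k(0,t)=\partial_xe_1^k(0,t)-\partial_xe_2^k(0,t),\quad t\in(0,T);$$ and update $g^k(t)=g^{k-1}(t)-\theta\left(\phi_1^k(0,t)+\phi_2^k(0,t)\right)$. Regularity conventions. Solutions $w\in\{e_i^k,\phi_i^k\}$ are classical: continuous on $\overline{\Omega_i}\times[-\tau,T]$,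 with $\partial_x w$ continuous on $\overline{\Omega_i}\times[0,T]$, and $\partial_t w,\partial_{xx}w$ continuous on $\Omega_i\times(0,T)$. An initial interface error $g^0$ is admissible if it is continuous on $[0,T]$ and all iterates $e_i^k,\phi_i^k$ exist as such classical solutions. Convergence. Let $\|g\|=\sup_{t\in[0,T]}|g(t)|$. The iteration converges linearly if, for every admissible $g^0\not\equiv0$, there is $\rho\in(0,1)$ with $g^{k}\not\equiv 0$ for all $k$ and $\lim_{k\to\infty}\|g^{k}\|/\|g^{k-1}\|=\rho$ (so in particular $g^k\to0$). It converges in two iterations if, for every admissible $g^0$, the errors $e_1^k$, $e_2^k$ and $g^k$ vanish identically for all $k\ge2$. *)

(* Defs.v *)
From HB Require Import structures.
From mathcomp Require Import all_boot all_order all_algebra.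
From mathcomp Require Import all_classical all_reals all_analysis.

Set Implicit Arguments.
Unset Strict Implicit.
Unset Printing Implicit Defensive.

Import Order.TTheory GRing.Theory Num.Theory.
Import numFieldNormedType.Exports.

Local Open Scope classical_set_scope.
Local Open Scope ring_scope.

(* A function [w] of (x, t) is a total map [R -> R -> R]; only its values for
   x in [lo, hi] and t in [- tau, T] are ever constrained or used. *)

Definition diff_quot (R : realType) (w : R -> R -> R) (x t : R) : R -> R :=
  fun y => (w y t - w x t) / (y - x).

(* The x-derivative relative to the closed interval [lo, hi]: two-sided at
   interior points, one-sided at the two end points. *)
Definition ex_dx (R : realType) (lo hi : R) (w : R -> R -> R) (x t : R) : Prop :=
  cvg (diff_quot w x t @ within `[lo, hi] x^').

Definition dx (R : realType) (lo hi : R) (w : R -> R -> R) (x t : R) : R :=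
  lim (diff_quot w x t @ within `[lo, hi] x^').

Definition dt (R : realType) (w : R -> R -> R) (x t : R) : R := derive1 (w x) t.

Definition dxx (R : realType) (w : R -> R -> R) (x t : R) : R :=
  derive1n 2 (w ^~ t) x.

Record classical (R : realType) (tau T lo hi : R) (w : R -> R -> R) : Prop :=
  Classical {
    classical_cont :
      {within `[lo, hi] `*` `[- tau, T], continuous (fun p => w p.1 p.2)};
    classical_ex_dx : forall x t, x \in `[lo, hi] -> t \in `[0, T] ->
      ex_dx lo hi w x t;
    classical_dx_cont :
      {within `[lo, hi] `*` `[0, T], continuous (fun p => dx lo hi w p.1 p.2)};
    classical_ex_dt : forall x t, x \in `]lo, hi[ -> t \in `]0, T[ ->
      derivable (w x) t 1;
    classical_dt_cont :
      {within `]lo, hi[ `*` `]0, T[, continuous (fun p => dt w p.1 p.2)};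
    classical_ex_dxx : forall x t, x \in `]lo, hi[ -> t \in `]0, T[ ->
      derivable (w ^~ t) x 1 /\ derivable (derive1 (w ^~ t)) x 1;
    classical_dxx_cont :
      {within `]lo, hi[ `*` `]0, T[, continuous (fun p => dxx w p.1 p.2)} }.

(* For t <= tau the delayed terms are evaluated in the history, where [w], hence
   also [dxx w], vanishes on the open interval. *)
Record zero_history_solution (R : realType) (tau mu c r d T lo hi : R)
    (w : R -> R -> R) : Prop := ZeroHistorySolution {
  zhs_classical : classical tau T lo hi w;
  zhs_pde : forall x t, x \in `]lo, hi[ -> t \in `]0, T[ ->
    dt w x t - mu ^+ 2 * dxx w x t
      - mu ^+ 2 * c ^+ 2 * dxx w x (t - tau)
      - r * w x t - d * w x (t - tau) = 0;
  zhs_history : forall x t, x \in `]lo, hi[ -> t \in `[- tau, 0] -> w x t = 0 }.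

Record nnwr_step (R : realType) (tau mu c r d T a b theta : R)
    (g : R -> R) (e1 e2 phi1 phi2 : R -> R -> R) (g' : R -> R) : Prop :=
  NNWRStep {
    nnwr_e1 : zero_history_solution tau mu c r d T (- a) 0 e1;
    nnwr_e2 : zero_history_solution tau mu c r d T 0 b e2;
    nnwr_e_outer : forall t, t \in `]0, T[ -> e1 (- a) t = 0 /\ e2 b t = 0;
    nnwr_e_interface : forall t, t \in `]0, T[ -> e1 0 t = g t /\ e2 0 t = g t;
    nnwr_phi1 : zero_history_solution tau mu c r d T (- a) 0 phi1;
    nnwr_phi2 : zero_history_solution tau mu c r d T 0 b phi2;
    nnwr_phi_outer : forall t, t \in `]0, T[ ->
      phi1 (- a) t = 0 /\ phi2 b t = 0;
    nnwr_phi_interface : forall t, t \in `]0, T[ ->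
      dx (- a) 0 phi1 0 t = dx (- a) 0 e1 0 t - dx 0 b e2 0 t /\
      - dx 0 b phi2 0 t = dx (- a) 0 e1 0 t - dx 0 b e2 0 t;
    nnwr_update : forall t, t \in `[0, T] ->
      g' t = g t - theta * (phi1 0 t + phi2 0 t) }.

(* [g k] is the interface error after k iterations; the subdomain errors
   [e1 k, e2 k, phi1 k, phi2 k] are meaningful for k >= 1 only. *)
Definition nnwr_iterates (R : realType) (tau mu c r d T a b theta : R)
    (g0 : R -> R) (e1 e2 phi1 phi2 : nat -> R -> R -> R)
    (g : nat -> R -> R) : Prop :=
  (forall t, t \in `[0, T] -> g 0%N t = g0 t) /\
  (forall k, nnwr_step tau mu c r d T a b theta
     (g k) (e1 k.+1) (e2 k.+1) (phi1 k.+1) (phi2 k.+1) (g k.+1)).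

Definition admissible (R : realType) (tau mu c r d T a b theta : R)
    (g0 : R -> R) : Prop :=
  {within `[0, T], continuous g0} /\
  exists e1 e2 phi1 phi2 g,
    nnwr_iterates tau mu c r d T a b theta g0 e1 e2 phi1 phi2 g.

Definition supnorm (R : realType) (T : R) (g : R -> R) : R :=
  sup [set `|g t| | t in `[0, T]].

Definition not_identically_zero (R : realType) (T : R) (g : R -> R) : Prop :=
  exists2 t, t \in `[0, T] & g t != 0.

(* The iterates are bound universally, so that no uniqueness result is built
   into the definition; existence is part of [admissible]. *)
Definition converges_linearly (R : realType)
    (tau mu c r d T a b theta : R) : Prop :=
  forall g0 : R -> R, admissible tau mu c r d T a b theta g0 ->
    not_identically_zero T g0 ->
    exists2 rho : R, 0 < rho < 1 &
      forall e1 e2 phi1 phi2 g,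
        nnwr_iterates tau mu c r d T a b theta g0 e1 e2 phi1 phi2 g ->
        (forall k, not_identically_zero T (g k)) /\
        supnorm T (g k.+1) / supnorm T (g k) @[k --> \oo] --> rho.

Definition converges_in_two_iterations (R : realType)
    (tau mu c r d T a b theta : R) : Prop :=
  forall g0 : R -> R, admissible tau mu c r d T a b theta g0 ->
    forall e1 e2 phi1 phi2 g,
      nnwr_iterates tau mu c r d T a b theta g0 e1 e2 phi1 phi2 g ->
      forall k, (2 <= k)%N ->
        [/\ forall x t, x \in `[- a, 0] -> t \in `[- tau, T] -> e1 k x t = 0,
            forall x t, x \in `[0, b] -> t \in `[- tau, T] -> e2 k x t = 0 &
            forall t, t \in `[0, T] -> g k t = 0].

(* Main.v *)
Require Import Defs.
From HB Require Import structures.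
From mathcomp Require Import all_boot all_order all_algebra.
From mathcomp Require Import all_classical all_reals all_analysis.
From mathcomp Require Import ring lra.
Import Order.TTheory GRing.Theory Num.Theory.
Import numFieldNormedType.Exports.
Local Open Scope classical_set_scope.
Local Open Scope ring_scope.

Set Implicit Arguments.
Unset Strict Implicit.
Unset Printing Implicit Defensive.

(* On the symmetric domain, x |-> - x exchanges the two Dirichlet problems, so
   e2(-x, t) = e1(x, t) and the flux jump is 2 dx e1(0, t); hence phi1 = 2 e1 and
   phi2(-x, t) = 2 e1(x, t) solve the Neumann problems, and the update is
   g^k = (1 - 4 theta) g^(k-1).  Everything thus rests on uniqueness for the
   delay problem with zero history, which the method of steps reduces to a
   maximum principle for w_t = k w_xx + r w. *)

(** * Derivative tests at a maximum *)

(** Left difference quotients at [t] are nonnegative, hence so is their limit. Comparing with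
    earlier times only, the test applies at the last time of a rectangle. *)
Lemma derive1_ge0_at_left_max (R : realType) (f : R -> R) (s t : R) :
  s < t -> (forall u, s < u <= t -> f u <= f t) -> derivable f t 1 ->
  0 <= derive1 f t.
Proof.
move=> st fmax df.
have cf : h^-1 *: (f (h + t) - f t) @[h --> 0^'-] --> derive1 f t.
  apply: cvg_dnbhs_at_left; have := df; rewrite /derivable /derive1.
  under eq_fun do rewrite /= /GRing.scale /= mulr1.
  exact.
rewrite leNgt; apply/negP => lt0.
have := cvgr_lt _ cf _ lt0; rewrite near_withinE => -[e /= e0 He].
pose h := - Num.min (e / 2) ((t - s) / 2).
have h0 : h < 0 by rewrite /h oppr_lt0 lt_min !divr_gt0 ?subr_gt0.
have hs : s < h + t.
  rewrite /h; have : Num.min (e / 2) ((t - s) / 2) <= (t - s) / 2 by rewrite ge_min lexx orbT.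
  lra.
have := He h; rewrite /ball /= sub0r normrN ltr0_norm // => /(_ _ h0).
have -> : - h < e.
  have : Num.min (e / 2) ((t - s) / 2) <= e / 2 by rewrite ge_min lexx.
  rewrite /h; lra.
move=> /(_ isT); apply/negP; rewrite -leNgt.
rewrite /GRing.scale /= nmulr_rge0 ?invr_lt0// subr_le0 fmax//; lra.
Qed.

(** The tilt [m * x] absorbs a linear penalty without affecting second derivatives. At the maximum
    [f' = m]; if [f'' > 0] there, then [f' > m] just to the right of [c], and the mean value theorem
    makes [f x - m * x] exceed its maximum. *)
Lemma derive2_le0_at_max (R : realType) (f : R -> R) (a b c m : R) :
  c \in `]a, b[ -> {in `]a, b[, forall x, derivable f x 1} ->
  derivable (derive1 f) c 1 ->
  (forall x, x \in `]a, b[ -> f x - m * x <= f c - m * c) ->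
  derive1n 2 f c <= 0.
Proof.
move=> cab df ddf fmax.
have /andP[ac cb] : a < c < b by move: cab; rewrite in_itv.
have fcm : (derive1 f) c = m.
  have dg x : x \in `]a, b[ -> is_derive x 1 (fun y => f y - m * y) ((derive1 f) x - m).
    move=> xab; have := derivableP (df _ xab); rewrite -derive1E => ?.
    apply: is_derive_eq; rewrite /GRing.scale /=; ring.
  have ab : a <= b by lra.
  have := derive1_at_max ab (fun t h => @ex_derive _ _ _ _ _ _ _ (dg t h)) cab fmax.
  have := dg _ cab => -[_ +] [_ +] => -> /eqP.
  by rewrite subr_eq0 => /eqP.
have cf : h^-1 *: ((derive1 f) (h + c) - m) @[h --> 0^'+] --> derive1n 2 f c.
  apply: cvg_dnbhs_at_right; have := ddf; rewrite -fcm /derivable /=.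
  rewrite [in X in _ -> X]/derive1.
  under eq_fun do rewrite /= [_ *: 1]/GRing.scale /= mulr1.
  exact.
rewrite leNgt; apply/negP => lt0.
have := cvgr_gt _ cf _ lt0; rewrite near_withinE => -[e /= e0 He].
pose h := Num.min (e / 2) ((b - c) / 2).
have h0 : 0 < h by rewrite /h lt_min !divr_gt0 ?subr_gt0.
have hb : c + h < b.
  have : h <= (b - c) / 2 by rewrite ge_min lexx orbT.
  lra.
have he : h < e.
  have : h <= e / 2 by rewrite ge_min lexx.
  lra.
have sub x : x \in `[c, c + h] -> x \in `]a, b[ by rewrite !in_itv /=; lra.
have [|x xch||x xch] := @MVT _ f (derive1 f) c (c + h).
- lra.
- rewrite derive1E; apply: derivableP; apply/df/sub; move: xch; rewrite !in_itv /=; lra.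
- apply: derivable_within_continuous => y yc; exact/df/sub.
have /andP[x1 x2] : c < x < c + h by move: xch; rewrite in_itv.
have /fmax : c + h \in `]a, b[ by apply: sub; rewrite in_itv /=; lra.
have := He (x - c); rewrite /ball /= sub0r normrN gtr0_norm; last lra.
have -> : x - c < e by lra.
have -> : 0 < x - c by lra.
move=> /(_ isT isT); rewrite subrK /GRing.scale /= pmulr_rgt0 ?invr_gt0 ?subr_gt0// => fx.
move=> H1 H2.
have : 0 < ((derive1 f) x - m) * h by rewrite mulr_gt0 ?subr_gt0.
lra.
Qed.

(** * Maximum principle for the heat operator *)

(** The right end may carry a Dirichlet or a zero-flux condition, so that one statement serves both
    subproblems of the iteration. The proof examines a positive maximum of a penalised function on
    the compact rectangle. *)
Lemma heat_max_principle (R : realType) (S lo hi k r : R) (w : R -> R -> R) :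
  lo < hi -> 0 <= k ->
  {within `[lo, hi] `*` `[0, S], continuous (fun p => w p.1 p.2)} ->
  (forall x : R, x \in `[lo, hi] -> w x 0 <= 0) ->
  (forall t : R, 0 < t <= S -> w lo t <= 0) ->
  (forall t : R, 0 < t <= S -> w hi t <= 0 \/
     diff_quot w hi t @ within `[lo, hi] hi^' --> (0 : R)) ->
  (forall x t : R, x \in `]lo, hi[ -> 0 < t <= S -> derivable (w x) t 1) ->
  (forall x t : R, x \in `]lo, hi[ -> 0 < t <= S ->
     derivable (w ^~ t) x 1 /\ derivable (derive1 (w ^~ t)) x 1) ->
  (forall x t : R, x \in `]lo, hi[ -> 0 < t <= S ->
     dt w x t <= k * dxx w x t + r * w x t) ->
  forall x t : R, x \in `[lo, hi] -> t \in `[0, S] -> w x t <= 0.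
Proof.
move=> lohi k0 cw w0 wlo whi dwt dwx pde x1 t1 x1I t1I.
rewrite leNgt; apply/negP => w1.
pose lam := r + 1.
pose E t := expR (- lam * t).
have E0 t : 0 < E t by exact: expR_gt0.
have len : 0 < hi - lo + 1 by lra.
(* With this [eps] the penalty removes at most half of [E t1 * w x1 t1], so [z] stays positive at
   [(x1, t1)]. *)
pose eps := E t1 * w x1 t1 / (2 * (hi - lo + 1)).
have eps0 : 0 < eps by rewrite divr_gt0 ?mulr_gt0.
(* The factor E turns r into - 1, which excludes interior maxima; the slope
   - eps of z excludes a maximum at a Neumann end point. *)
pose z (p : R * R) := E p.2 * w p.1 p.2 - eps * (p.1 - lo + 1).
have cE : continuous E.
  move=> t; apply: continuous_comp; last exact: continuous_expR.
  exact: mulrl_continuous.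
have cz : {within `[lo, hi] `*` `[0, S], continuous z}.
  apply/subspace_continuousP => p pI; apply: cvgB.
    apply: cvgM; last by move/subspace_continuousP: cw => /(_ p pI).
    apply: cvg_within_filter.
    by apply: (@cvg_comp _ _ _ snd E _ (nbhs p.2)); [exact: cvg_snd|exact: cE].
  apply: cvg_within_filter.
  apply: cvgM; first exact: cvg_cst.
  apply: cvgD; last exact: cvg_cst.
  apply: cvgB; [exact: cvg_fst|exact: cvg_cst].
have [||[x0 t0]] := @compact_EVT_max _ _ z (`[lo, hi] `*` `[0, S]) _ _ cz.
- by exists (x1, t1).
- by apply: compact_setX; exact: segment_compact.
rewrite inE /= => -[x0I t0I] zmax.
have z1 : 0 < z (x1, t1).
  rewrite /z /= subr_gt0.
  have : eps * (x1 - lo + 1) <= eps * (hi - lo + 1).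
    by rewrite ler_pM2l//; move: x1I; rewrite in_itv /=; lra.
  have -> : eps * (hi - lo + 1) = E t1 * w x1 t1 / 2 by rewrite /eps; field; lra.
  have : 0 < E t1 * w x1 t1 by rewrite mulr_gt0.
  lra.
have zmax' x t : x \in `[lo, hi] -> t \in `[0, S] -> z (x, t) <= z (x0, t0).
  by move=> xI tI; apply: zmax; rewrite inE.
have {z1} z0 : 0 < z (x0, t0) by apply: lt_le_trans z1 (zmax' _ _ x1I t1I).
move: (x0I) (t0I); rewrite !in_itv /= => /andP[x0lo x0hi] /andP[t00 t0S].
(* Both [z] and the penalty are positive at the maximum, so [w] is too; this excludes the initial
   time and the left end. *)
have {z0} wpos : 0 < w x0 t0.
  rewrite -(pmulr_rgt0 _ (E0 t0)).
  have : 0 < eps * (x0 - lo + 1) by rewrite mulr_gt0//; lra.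
  by move: z0; rewrite /z /=; lra.
have tpos : 0 < t0 <= S.
  rewrite t0S andbT lt_neqAle t00 andbT; apply/eqP => t0E.
  by move: wpos; rewrite -t0E ltNge w0.
have xneqlo : x0 != lo.
  by apply/eqP => xE; move: wpos; rewrite xE ltNge wlo.
have max_x x : x \in `[lo, hi] -> E t0 * (w x t0 - w x0 t0) <= eps * (x - x0).
  by move=> /zmax' /(_ t0I); rewrite /z /=; lra.
(* At [hi], maximality keeps the difference quotients from the left at or above [eps / E t0 > 0],
   against their limit 0. *)
have [xE|xneqhi] := eqVneq x0 hi.
  have [|dq] := whi _ tpos; first by rewrite -xE leNgt wpos.
  have m0 : 0 < eps / E t0 by rewrite divr_gt0.
  have := cvgr_lt _ dq _ m0; rewrite near_withinE near_withinE => -[e /= e0 He].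
  pose h := Num.min (e / 2) ((hi - lo) / 2).
  have h0 : 0 < h by rewrite /h lt_min !divr_gt0 ?subr_gt0.
  have hb : h <= (hi - lo) / 2 by rewrite ge_min lexx orbT.
  have he : h <= e / 2 by rewrite ge_min lexx.
  have hI : hi - h \in `[lo, hi] by rewrite in_itv /=; lra.
  have := He (hi - h); rewrite /ball /= opprB addrC subrK gtr0_norm//.
  have -> : h < e by lra.
  have -> : hi - h != hi by rewrite lt_eqF//; lra.
  move=> /(_ isT isT hI); apply/negP; rewrite -leNgt /diff_quot.
  rewrite ler_ndivlMr; last lra.
  have := max_x _ hI; rewrite xE mulrC -ler_pdivlMr// => /le_trans; apply.
  by rewrite mulrAC.
have x0oo : x0 \in `]lo, hi[ by rewrite in_itv /= !lt_neqAle eq_sym xneqlo xneqhi x0lo.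
have [dx1 dx2] := dwx _ _ x0oo tpos.
have sub x : x \in `]lo, hi[ -> x \in `[lo, hi] by rewrite !in_itv /=; lra.
have xx0 : dxx w x0 t0 <= 0.
  apply: (@derive2_le0_at_max _ _ lo hi _ (eps / E t0)) => //.
    by move=> x xI; case: (dwx _ _ xI tpos).
  move=> x /sub /max_x; rewrite mulrC -ler_pdivlMr//; lra.
have t_ge : lam * w x0 t0 <= dt w x0 t0.
  have dwx0 := derivableP (dwt _ _ x0oo tpos); rewrite -derive1E in dwx0.
  have dE : is_derive t0 1 E (- lam * E t0).
    have dl : is_derive t0 1 (fun t => - lam * t) (- lam).
      by apply: is_derive_eq; rewrite /GRing.scale /= mulr1.
    have := @is_derive1_comp _ expR (fun t => - lam * t) t0 _ _ _ dl.
    by move=> /(_ _ (is_derive_expR _)); rewrite mulrC.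
  have dEw : is_derive t0 1 (fun t => E t * w x0 t)
      (E t0 * (dt w x0 t0 - lam * w x0 t0)).
    apply: is_derive_eq; rewrite /GRing.scale /= /dt; ring.
  have := @derive1_ge0_at_left_max _ (fun t => E t * w x0 t) 0 t0.
  rewrite derive1E (@derive_val _ _ _ _ _ _ _ dEw) pmulr_rge0// subr_ge0; apply.
  - by case/andP: tpos.
  - move=> u u0; have uI : u \in `[0, S] by rewrite in_itv /=; lra.
    by have := zmax' _ _ x0I uI; rewrite /z /=; lra.
  - exact: ex_derive.
(* Since [dxx w x0 t0 <= 0], the bounds read [(r + 1) * w <= dt w <= r * w] at a point where
   [w > 0]. *)
have := pde _ _ x0oo tpos.
have : k * dxx w x0 t0 <= 0 by rewrite mulr_ge0_le0.
by rewrite /lam in t_ge; lra.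
Qed.

(** * Slices, and passage from open to closed intervals *)

Lemma continuous_slice1 (R : realType) (A B : set R) (w : R -> R -> R) t :
  {within A `*` B, continuous (fun p => w p.1 p.2)} -> B t ->
  {within A, continuous (w ^~ t)}.
Proof.
move=> /subspace_continuousP cw Bt; apply/subspace_continuousP => x Ax.
apply: (@cvg_comp _ _ _ (fun x => (x, t)) (fun p => w p.1 p.2) _
  (within (A `*` B) (nbhs (x, t)))); last exact: (cw (x, t)).
move=> P [[U V] [/= nU nV] UV]; apply: filterS nU => y Uy Ay.
by apply: (UV (y, t)) => //; split=> //=; exact: nbhs_singleton.
Qed.

Lemma continuous_slice2 (R : realType) (A B : set R) (w : R -> R -> R) x :
  {within A `*` B, continuous (fun p => w p.1 p.2)} -> A x ->
  {within B, continuous (w x)}.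
Proof.
move=> /subspace_continuousP cw Ax; apply/subspace_continuousP => t Bt.
apply: (@cvg_comp _ _ _ (fun t => (x, t)) (fun p => w p.1 p.2) _
  (within (A `*` B) (nbhs (x, t)))); last exact: (cw (x, t)).
move=> P [[U V] [/= nU nV] UV]; apply: filterS nV => y Vy By.
by apply: (UV (x, y)) => //; split=> //=; exact: nbhs_singleton.
Qed.

(** End values are limits from inside. This carries history, interface data and vanishing, known on
    open intervals, to the closed ones. *)
Lemma itvcc_eq_of_itvoo (R : realType) (a b : R) (f g : R -> R) :
  a < b -> {within `[a, b], continuous f} -> {within `[a, b], continuous g} ->
  {in `]a, b[, f =1 g} -> {in `[a, b], f =1 g}.
Proof.
move=> ab /(continuous_within_itvP _ ab)[_ fa fb].
move=> /(continuous_within_itvP _ ab)[_ ga gb] fg x.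
have fga : f a = g a.
  apply: (cvg_unique _ fa) => //.
  apply: cvg_trans ga; apply: near_eq_cvg.
  near=> y; apply/esym/fg; rewrite in_itv /=; apply/andP; split; near: y.
    exact: nbhs_right_gt.
  exact: nbhs_right_lt.
have fgb : f b = g b.
  apply: (cvg_unique _ fb) => //.
  apply: cvg_trans gb; apply: near_eq_cvg.
  near=> y; apply/esym/fg; rewrite in_itv /=; apply/andP; split; near: y.
    exact: nbhs_left_gt.
  exact: nbhs_left_lt.
rewrite in_itv /= !le_eqVlt => /andP[/predU1P[<-//|ax] /predU1P[->//|xb]].
by apply: fg; rewrite in_itv /= ax.
Unshelve. all: by end_near. Qed.

(** * Second derivatives on an open interval *)

(** The derivatives are explicit functions: [derive1 f] is known in closed form only on the
    interval, and [derive1n 2 f] differentiates it again. *)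
Definition is_derive2 (R : realType) (lo hi : R) (f f1 f2 : R -> R) : Prop :=
  forall x : R, x \in `]lo, hi[ -> is_derive x 1 f (f1 x) /\ is_derive x 1 f1 (f2 x).

Lemma is_derive2P (R : realType) (lo hi : R) (f : R -> R) :
  (forall x : R, x \in `]lo, hi[ -> derivable f x 1 /\ derivable (derive1 f) x 1) ->
  is_derive2 lo hi f (derive1 f) (derive1n 2 f).
Proof.
by move=> df x /df[d1 d2]; split; rewrite /= derive1E; exact: derivableP.
Qed.

Lemma is_derive_eq_itvoo (R : realType) (lo hi x l : R) (f g : R -> R) :
  x \in `]lo, hi[ -> {in `]lo, hi[, f =1 g} ->
  is_derive x 1 f l -> is_derive x 1 g l.
Proof.
move=> xI fg; apply: near_eq_is_derive.
by near=> y; apply: fg; near: y; exact: near_in_itvoo.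
Unshelve. all: by end_near. Qed.

Lemma is_derive2_derivable (R : realType) (lo hi : R) (f f1 f2 : R -> R) :
  is_derive2 lo hi f f1 f2 -> forall x : R, x \in `]lo, hi[ ->
  derivable f x 1 /\ derivable (derive1 f) x 1.
Proof.
move=> df x xI; have [d1 d2] := df _ xI; split; first exact: ex_derive.
suff : is_derive x 1 (derive1 f) (f2 x) by move=> ?; exact: ex_derive.
apply: is_derive_eq_itvoo xI _ d2 => y yI; have [? _] := df _ yI.
by rewrite derive1E derive_val.
Qed.

Lemma is_derive2_val (R : realType) (lo hi : R) (f f1 f2 : R -> R) :
  is_derive2 lo hi f f1 f2 -> {in `]lo, hi[, derive1n 2 f =1 f2}.
Proof.
move=> df x xI; have [d1 d2] := df _ xI; rewrite /= derive1E.
suff : is_derive x 1 (derive1 f) (f2 x) by move=> ?; rewrite derive_val.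
apply: is_derive_eq_itvoo xI _ d2 => y yI; have [? _] := df _ yI.
by rewrite derive1E derive_val.
Qed.

(** Removes the delayed diffusion term wherever the delayed values vanish, in particular in the
    history. *)
Lemma dxx_eq0 (R : realType) (lo hi t : R) (w : R -> R -> R) :
  (forall x : R, x \in `]lo, hi[ -> w x t = 0) ->
  forall x : R, x \in `]lo, hi[ -> dxx w x t = 0.
Proof.
move=> w0; apply: (@is_derive2_val _ _ _ _ (cst 0)) => x xI.
split; last exact: is_derive_cst.
by apply: is_derive_eq_itvoo xI _ (is_derive_cst 0 x 1) => y /w0.
Qed.

Lemma is_derive2_lincomb (R : realType) (lo hi p q : R)
    (f f1 f2 g g1 g2 : R -> R) :
  is_derive2 lo hi f f1 f2 -> is_derive2 lo hi g g1 g2 ->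
  is_derive2 lo hi (fun x => p * f x + q * g x)
    (fun x => p * f1 x + q * g1 x) (fun x => p * f2 x + q * g2 x).
Proof.
by move=> df dg x xI; have [? ?] := df _ xI; have [? ?] := dg _ xI; split;
  apply: is_derive_eq; rewrite /GRing.scale /=; ring.
Qed.

Lemma is_derive_reflect (R : realType) (f : R -> R) (x l : R) :
  is_derive (- x) 1 f l -> is_derive x 1 (fun y => f (- y)) (- l).
Proof.
move=> df; have dN : is_derive x 1 (fun y : R => - y) (-1 : R) by apply: is_derive_eq.
have := @is_derive1_comp _ f (fun y : R => - y) x _ _ df dN.
by rewrite mulrN1.
Qed.

Lemma is_derive2_reflect (R : realType) (lo hi : R) (f f1 f2 : R -> R) :
  is_derive2 lo hi f f1 f2 ->
  is_derive2 (- hi) (- lo) (fun x => f (- x)) (fun x => - f1 (- x))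
    (fun x => f2 (- x)).
Proof.
move=> df x xI; have [|/is_derive_reflect ? /is_derive_reflect d2] := df (- x).
  by move: xI; rewrite !in_itv /=; lra.
split=> //.
have : is_derive x 1 (- (fun y => f1 (- y))) (- - f2 (- x)) by exact: is_deriveN.
by rewrite opprK.
Qed.

(** * Linearity and reflection symmetry of the equation *)

(** A weakening of [zero_history_solution] closed under linear combinations and reflection, with the
    equation solved for [dt w]. Boundary fluxes are tracked separately through [diff_quot]. *)
Record interior_solution (R : realType) (tau mu c r d T lo hi : R)
    (w : R -> R -> R) : Prop := InteriorSolution {
  isol_cont : {within `[lo, hi] `*` `[- tau, T],
    continuous (fun p => w p.1 p.2)};
  isol_ex_dt : forall x t : R, x \in `]lo, hi[ -> t \in `]0, T[ ->
    derivable (w x) t 1;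
  isol_ex_dxx : forall x t : R, x \in `]lo, hi[ -> t \in `]0, T[ ->
    derivable (w ^~ t) x 1 /\ derivable (derive1 (w ^~ t)) x 1;
  isol_pde : forall x t : R, x \in `]lo, hi[ -> t \in `]0, T[ ->
    dt w x t = mu ^+ 2 * dxx w x t + mu ^+ 2 * c ^+ 2 * dxx w x (t - tau)
      + r * w x t + d * w x (t - tau);
  isol_history : forall x t : R, x \in `]lo, hi[ -> t \in `[- tau, 0] -> w x t = 0 }.

Lemma zero_history_interior_solution (R : realType)
    (tau mu c r d T lo hi : R) (w : R -> R -> R) :
  zero_history_solution tau mu c r d T lo hi w ->
  interior_solution tau mu c r d T lo hi w.
Proof.
move=> [[cw _ _ dtw _ dxxw _] pde hist]; split=> // x t xI tI.
have := pde _ _ xI tI.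
move: (dt w x t) (dxx w x t) (dxx w x (t - tau)) (w x t) (w x (t - tau)).
by move=> w_t w_xx w_xx' w0 w1; lra.
Qed.

Section InteriorSolution.
Variables (R : realType) (tau mu c r d T lo hi : R).
Hypotheses (tau_gt0 : 0 < tau).

Lemma interior_solution_dxx_history (w : R -> R -> R) (t : R) :
  interior_solution tau mu c r d T lo hi w -> 0 < t <= tau ->
  {in `]lo, hi[, forall x : R, dxx w x (t - tau) = 0}.
Proof.
move=> sw tI; apply: dxx_eq0 => x xI; apply: (isol_history sw xI).
by rewrite in_itv /=; lra.
Qed.

Lemma interior_solution_lincomb (p q : R) (v w : R -> R -> R) :
  interior_solution tau mu c r d T lo hi v ->
  interior_solution tau mu c r d T lo hi w ->
  interior_solution tau mu c r d T lo hi (fun x t => p * v x t + q * w x t).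
Proof.
move=> sv sw.
have der (t : R) : t \in `]0, T[ -> is_derive2 lo hi
    (fun x => p * v x t + q * w x t)
    (fun x => p * derive1 (v ^~ t) x + q * derive1 (w ^~ t) x)
    (fun x => p * dxx v x t + q * dxx w x t).
  by move=> tI; apply: is_derive2_lincomb; apply: is_derive2P => x xI;
    [exact: isol_ex_dxx sv _ _ xI tI|exact: isol_ex_dxx sw _ _ xI tI].
have dert (x t : R) : x \in `]lo, hi[ -> t \in `]0, T[ -> is_derive t 1
    (fun t => p * v x t + q * w x t) (p * dt v x t + q * dt w x t).
  move=> xI tI; have := derivableP (isol_ex_dt sv xI tI).
  have := derivableP (isol_ex_dt sw xI tI); rewrite -!derive1E => ? ?.
  by apply: is_derive_eq; rewrite /GRing.scale /= /dt; ring.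
have hist (x t : R) : x \in `]lo, hi[ -> t \in `[- tau, 0] -> p * v x t + q * w x t = 0.
  by move=> xI tI; rewrite (isol_history sv xI tI) (isol_history sw xI tI) !mulr0 addr0.
split=> //.
- apply/subspace_continuousP => y yI; apply: cvgD; apply: cvgM;
    [exact: cvg_cst| |exact: cvg_cst|].
  + by have /subspace_continuousP := isol_cont sv; exact.
  + by have /subspace_continuousP := isol_cont sw; exact.
- by move=> x t xI tI; have := dert _ _ xI tI => ?; exact: ex_derive.
- by move=> x t xI tI; exact: is_derive2_derivable (der _ tI) _ xI.
move=> x t xI tI.
have := dert _ _ xI tI => ?; rewrite {1}/dt derive1E derive_val.
rewrite [X in _ = _ * X + _ + _ + _](is_derive2_val (der _ tI) xI).
have -> : dxx (fun x t => p * v x t + q * w x t) x (t - tau)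
    = p * dxx v x (t - tau) + q * dxx w x (t - tau).
  (* For [t > tau] the delayed time lies in []0, T[], where the derivatives exist; for [t <= tau] it
     lies in the history, where every term is zero. *)
  have [ttau|taut] := leP t tau.
    have tI' : 0 < t <= tau by move: tI; rewrite in_itv /=; lra.
    rewrite (interior_solution_dxx_history sv tI' xI).
    rewrite (interior_solution_dxx_history sw tI' xI) !mulr0 addr0.
    apply: dxx_eq0 xI => y yI; apply: hist => //.
    by rewrite in_itv /=; lra.
  apply: (is_derive2_val (der (t - tau) _) xI).
  by move: tI tau_gt0; rewrite !in_itv /=; lra.
rewrite (isol_pde sv xI tI) (isol_pde sw xI tI).
move: (dxx v x t) (dxx v x (t - tau)) (dxx w x t) (dxx w x (t - tau)).
move: (v x t) (v x (t - tau)) (w x t) (w x (t - tau)) => v0 v1 w0 w1 v2 v3 w2 w3.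
ring.
Qed.

(** The equation contains only even derivatives in [x], so [x |-> - x] preserves it. *)
Lemma interior_solution_reflect (w : R -> R -> R) :
  interior_solution tau mu c r d T lo hi w ->
  interior_solution tau mu c r d T (- hi) (- lo) (fun x t => w (- x) t).
Proof.
move=> sw.
have NI (x : R) : x \in `]- hi, - lo[ -> - x \in `]lo, hi[ by rewrite !in_itv /=; lra.
have der (t : R) : t \in `]0, T[ -> is_derive2 (- hi) (- lo) (fun x => w (- x) t)
    (fun x => - derive1 (w ^~ t) (- x)) (fun x => dxx w (- x) t).
  move=> tI; apply: (@is_derive2_reflect _ _ _ (w ^~ t)).
  by apply: is_derive2P => x xI; exact: isol_ex_dxx sw _ _ xI tI.
have hist (x t : R) : x \in `]- hi, - lo[ -> t \in `[- tau, 0] -> w (- x) t = 0.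
  by move=> /NI xI tI; exact: isol_history sw _ _ xI tI.
split=> //.
- apply/subspace_continuousP => -[x t] [/= xI tI].
  apply: (@cvg_comp _ _ _ (fun p => (- p.1, p.2)) (fun p => w p.1 p.2) _
    (within (`[lo, hi] `*` `[- tau, T]) (nbhs (- x, t)))); last first.
    have /subspace_continuousP := isol_cont sw; apply; split=> //=.
    by move: xI; rewrite !in_itv /=; lra.
  have cN : (- p.1, p.2) @[p --> (x, t)] --> (- x, t).
    have c1 : - p.1 @[p --> (x, t)] --> - x by apply: cvgN; exact: cvg_fst.
    have c2 : p.2 @[p --> (x, t)] --> t by exact: cvg_snd.
    apply: cvg_pair c1 c2.
  move=> P /cN nP; apply: (@filterS _ (nbhs (x, t)) _ _ _ _ nP).
  move=> [y s] /= PN [/= yI sI]; apply: PN; split=> //=.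
  by move: yI; rewrite !in_itv /=; lra.
- by move=> x t /NI xI tI; exact: isol_ex_dt sw _ _ xI tI.
- by move=> x t xI tI; exact: is_derive2_derivable (der _ tI) _ xI.
move=> x t xI tI.
transitivity (dt w (- x) t) => //; rewrite (isol_pde sw (NI _ xI) tI).
rewrite [X in _ = _ * X + _ + _ + _](is_derive2_val (der _ tI) xI).
have -> // : dxx (fun x t => w (- x) t) x (t - tau) = dxx w (- x) (t - tau).
have [ttau|taut] := leP t tau.
  have tI' : 0 < t <= tau by move: tI; rewrite in_itv /=; lra.
  rewrite (interior_solution_dxx_history sw tI' (NI _ xI)).
  apply: dxx_eq0 xI => y yI; apply: hist => //.
  by rewrite in_itv /=; lra.
apply: (is_derive2_val (der (t - tau) _) xI).
by move: tI tau_gt0; rewrite !in_itv /=; lra.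
Qed.

End InteriorSolution.

(** * Boundary fluxes as limits of difference quotients *)

Lemma diff_quot_lincomb (R : realType) (F : set_system R) {FF : Filter F}
    (p q l m x t : R) (v w : R -> R -> R) :
  diff_quot v x t @ F --> l -> diff_quot w x t @ F --> m ->
  diff_quot (fun x t => p * v x t + q * w x t) x t @ F --> p * l + q * m.
Proof.
move=> cv cw.
have -> : diff_quot (fun x t => p * v x t + q * w x t) x t =
    fun y => p * diff_quot v x t y + q * diff_quot w x t y.
  by apply/funext => y; rewrite /diff_quot; ring.
by apply: cvgD; apply: cvgM => //; exact: cvg_cst.
Qed.

Lemma diff_quot_reflect (R : realType) (lo hi l t : R) (w : R -> R -> R) (x : R) :
  diff_quot w (- x) t @ within `[lo, hi] (- x)^' --> l ->
  diff_quot (fun x t => w (- x) t) x t @ within `[- hi, - lo] x^' --> - l.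
Proof.
move=> cw.
have -> : diff_quot (fun x t => w (- x) t) x t =
    fun y => - diff_quot w (- x) t (- y).
  by apply/funext => y; rewrite /diff_quot -opprD invrN mulrN opprK.
apply: cvgN; apply: (@cvg_comp _ _ _ (fun y : R => - y) _ _
  (within `[lo, hi] (- x)^')) => //.
have cN : - y @[y --> x] --> - x by apply: cvgN; exact: cvg_id.
move=> P /cN nP; apply: (@filterS _ (nbhs x) _ _ _ _ nP).
move=> y /= PN yx yI; apply: PN; first by rewrite eqr_opp.
by move: yI; rewrite /= !in_itv /=; lra.
Qed.

Lemma dx_cvg (R : realType) (tau T lo hi x t : R) (w : R -> R -> R) :
  classical tau T lo hi w -> x \in `[lo, hi] -> t \in `]0, T[ ->
  diff_quot w x t @ within `[lo, hi] x^' --> dx lo hi w x t.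
Proof.
move=> cw xI tI; apply: (classical_ex_dx cw) => //.
by move: tI; rewrite !in_itv /=; lra.
Qed.

(** * Uniqueness for the delay problem with zero history *)

Section Uniqueness.
Variables (R : realType) (tau mu c r d T lo hi : R).
Hypotheses (tau_gt0 : 0 < tau) (T_gt0 : 0 < T) (lo_lt_hi : lo < hi).

Local Notation sol := (interior_solution tau mu c r d T lo hi).

Lemma interior_solution_history (w : R -> R -> R) (x t : R) :
  sol w -> x \in `[lo, hi] -> t \in `[- tau, 0] -> w x t = 0.
Proof.
move=> sw xI tI.
have cw : {within `[lo, hi], continuous (w ^~ t)}.
  apply: continuous_slice1 (isol_cont sw) _ => /=.
  by move: tI T_gt0; rewrite !in_itv /=; lra.
have c0 : {within `[lo, hi], continuous (cst 0 : R -> R)}.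
  by apply: continuous_subspaceT => ?; exact: cvg_cst.
apply: (itvcc_eq_of_itvoo lo_lt_hi cw c0 _ xI) => y yI.
exact: (isol_history sw yI tI).
Qed.

(** Once the delayed values vanish up to time [t], the equation is a heat equation with reaction
    term [r * w]. As [t < T], it holds at the final time [t] as well, as the maximum principle
    requires. *)
Lemma interior_solution_le0 (w : R -> R -> R) (t : R) :
  sol w -> t \in `]0, T[ ->
  (forall s : R, s \in `]0, T[ -> w lo s = 0) ->
  (forall s : R, s \in `]0, T[ -> w hi s = 0 \/
     diff_quot w hi s @ within `[lo, hi] hi^' --> (0 : R)) ->
  (forall x s : R, x \in `]lo, hi[ -> 0 < s <= t -> w x (s - tau) = 0) ->
  forall x, x \in `[lo, hi] -> w x t <= 0.
Proof.
move=> sw tI wlo whi delay x xI.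
have sub (s : R) : 0 < s <= t -> s \in `]0, T[.
  by move: tI; rewrite !in_itv /=; lra.
apply: (@heat_max_principle _ t lo hi (mu ^+ 2) r w) => //.
- exact: sqr_ge0.
- apply: continuous_subspaceW (isol_cont sw) => -[y s] [/= yI sI]; split=> //=.
  by move: sI tI tau_gt0; rewrite !in_itv /=; lra.
- move=> y yI; rewrite (interior_solution_history sw yI)//.
  by move: tau_gt0; rewrite in_itv /=; lra.
- by move=> s /sub /wlo ->.
- by move=> s /sub /whi[->|]; [left|right].
- by move=> y s yI /sub sI; exact: isol_ex_dt sw _ _ yI sI.
- by move=> y s yI /sub sI; exact: isol_ex_dxx sw _ _ yI sI.
- move=> y s yI sI; rewrite (isol_pde sw yI (sub _ sI)) (delay _ _ yI sI).
  have -> : dxx w y (s - tau) = 0 by apply: (dxx_eq0 _ yI) => u uI; exact: delay.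
  by rewrite !mulr0 !addr0.
- by move: tI; rewrite !in_itv /=; lra.
Qed.

(* Method of steps: on each time slab of length [tau] the delayed terms vanish
   by the previous slab, leaving a heat equation. *)
Lemma interior_solution_eq0 (w : R -> R -> R) :
  sol w ->
  (forall s : R, s \in `]0, T[ -> w lo s = 0) ->
  (forall s : R, s \in `]0, T[ -> w hi s = 0 \/
     diff_quot w hi s @ within `[lo, hi] hi^' --> (0 : R)) ->
  forall x t : R, x \in `[lo, hi] -> t \in `[- tau, T] -> w x t = 0.
Proof.
move=> sw wlo whi.
(* This is [- w], written as a linear combination to inherit the equation; its upper bound is the
   lower bound for [w]. *)
pose v (x t : R) := -1 * w x t + 0 * w x t.
have vE x t : v x t = - w x t by rewrite /v; ring.
have sv : sol v by exact: interior_solution_lincomb.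
have vhi (s : R) : s \in `]0, T[ -> v hi s = 0 \/
    diff_quot v hi s @ within `[lo, hi] hi^' --> (0 : R).
  move=> /whi[w0|dw]; first by left; rewrite vE w0 oppr0.
  right; have -> : 0 = -1 * 0 + 0 * 0 :> R by ring.
  exact: diff_quot_lincomb.
have step (n : nat) (t : R) : t \in `]0, T[ -> t < n%:R * tau ->
    forall x, x \in `[lo, hi] -> w x t = 0.
  elim: n t => [|n IH] t tI tn x xI.
    by move: tI tn; rewrite mul0r in_itv /=; lra.
  have delay (y s : R) : y \in `]lo, hi[ -> 0 < s <= t -> w y (s - tau) = 0.
    (* The delayed time falls either in the history or below [n * tau], where the induction
       hypothesis applies. *)
    move=> yI sI; have [stau|taus] := lerP s tau.
      by apply: (isol_history sw yI); rewrite in_itv /=; lra.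
    apply: IH.
    - by move: tI tau_gt0; rewrite !in_itv /=; lra.
    - by move: tn; rewrite -natr1; lra.
    - by move: yI; rewrite !in_itv /=; lra.
  apply/eqP; rewrite eq_le; apply/andP; split.
    exact: (interior_solution_le0 sw tI wlo whi delay).
  rewrite -oppr_le0 -vE.
  apply: (interior_solution_le0 sv tI _ vhi) => //.
    by move=> s /wlo w0; rewrite vE w0 oppr0.
  by move=> y s yI sI; rewrite vE delay// oppr0.
move=> x t xI; rewrite in_itv /= => /andP[tlo tT].
have [t0|t0] := lerP t 0.
  by apply: interior_solution_history => //; rewrite in_itv /= tlo.
(* The slabs cover only times below [T]; the final time follows by continuity. *)
have cw : {within `[0, T], continuous (w x)}.
  apply: (@continuous_subspaceW _ _ _ `[- tau, T]).
    by move=> s /=; move: tau_gt0; rewrite !in_itv /=; lra.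
  exact: continuous_slice2 (isol_cont sw) xI.
have c0 : {within `[0, T], continuous (cst 0 : R -> R)}.
  by apply: continuous_subspaceT => ?; exact: cvg_cst.
apply: (itvcc_eq_of_itvoo T_gt0 cw c0); last by rewrite in_itv /= ltW.
move=> s sI; apply: (step (Num.bound (s / tau)) s) => //.
rewrite -ltr_pdivrMr//; apply/archi_boundP/divr_ge0; last exact: ltW.
by move: sI; rewrite in_itv /= => /andP[/ltW].
Qed.

End Uniqueness.

(** * One iteration on equal subdomains *)

Section EqualSubdomains.
Variables (R : realType) (tau mu c r d T a theta : R).
Hypotheses (tau_gt0 : 0 < tau) (T_gt0 : 0 < T) (a_gt0 : 0 < a).

Local Notation sol := (interior_solution tau mu c r d T (- a) 0).
Local Notation step := (nnwr_step tau mu c r d T a a theta).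

Let lo_lt_hi : - a < 0. Proof. by rewrite oppr_lt0. Qed.
Let hi_in : 0 \in `[- a, 0]. Proof. by rewrite in_itv /= lexx andbT ltW. Qed.

(** Moves the problems of the right subdomain to [[- a, 0]], where they can be compared with the
    left ones. *)
Lemma reflect_solution (w : R -> R -> R) :
  zero_history_solution tau mu c r d T 0 a w -> sol (fun x t => w (- x) t).
Proof.
move=> /zero_history_interior_solution sw.
by have := interior_solution_reflect tau_gt0 sw; rewrite oppr0.
Qed.

Lemma reflect_dx_cvg (w : R -> R -> R) (t : R) :
  zero_history_solution tau mu c r d T 0 a w -> t \in `]0, T[ ->
  diff_quot (fun x t => w (- x) t) 0 t @ within `[- a, 0] 0^' --> - dx 0 a w 0 t.
Proof.
move=> sw tI; rewrite -[X in within `[_, X] _]oppr0; apply: diff_quot_reflect.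
rewrite oppr0; apply: (dx_cvg (zhs_classical sw)) => //.
by rewrite in_itv /= lexx ltW.
Qed.

Lemma solution_dirichlet_eq0 (w : R -> R -> R) : sol w ->
  (forall t : R, t \in `]0, T[ -> w (- a) t = 0) ->
  (forall t : R, t \in `]0, T[ -> w 0 t = 0) ->
  forall x t : R, x \in `[- a, 0] -> t \in `[- tau, T] -> w x t = 0.
Proof.
move=> sw w1 w2; apply: (interior_solution_eq0 tau_gt0 T_gt0 lo_lt_hi sw) => //.
by move=> s sI; left; exact: w2.
Qed.

(** Zero interface data make both Dirichlet problems homogeneous, the right one after reflection. *)
Lemma nnwr_step_eq0 g e1 e2 phi1 phi2 g' : step g e1 e2 phi1 phi2 g' ->
  (forall t : R, t \in `]0, T[ -> g t = 0) ->
  (forall x t : R, x \in `[- a, 0] -> t \in `[- tau, T] -> e1 x t = 0) /\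
  (forall x t : R, x \in `[0, a] -> t \in `[- tau, T] -> e2 x t = 0).
Proof.
move=> [/zero_history_interior_solution s1 /reflect_solution s2 out int _ _ _ _ _] g0.
split; first apply: (solution_dirichlet_eq0 s1) => t tI.
- by case: (out t tI).
- by case: (int t tI) => -> _; exact: g0.
move=> x t xI tI; rewrite -[x]opprK.
apply: (solution_dirichlet_eq0 s2) => // [s sI|s sI|].
- by rewrite opprK; case: (out s sI).
- by rewrite oppr0; case: (int s sI) => _ ->; exact: g0.
- by move: xI; rewrite !in_itv /=; lra.
Qed.

(** Both sides solve the same Dirichlet problem, so their difference solves the homogeneous one. *)
Lemma nnwr_step_reflect_e2 g e1 e2 phi1 phi2 g' : step g e1 e2 phi1 phi2 g' ->
  forall x t : R, x \in `[- a, 0] -> t \in `[- tau, T] -> e2 (- x) t = e1 x t.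
Proof.
move=> [/zero_history_interior_solution s1 /reflect_solution s2 out int _ _ _ _ _].
move=> x t xI tI.
have sw := interior_solution_lincomb tau_gt0 1 (-1) s2 s1.
have := solution_dirichlet_eq0 sw _ _ xI tI.
rewrite mul1r mulN1r => H; apply/eqP; rewrite -subr_eq0; apply/eqP; apply: H.
- by move=> s sI; rewrite opprK; case: (out s sI) => -> ->; ring.
- by move=> s sI; rewrite oppr0; case: (int s sI) => -> ->; ring.
Qed.

Lemma nnwr_step_dx_e2 g e1 e2 phi1 phi2 g' : step g e1 e2 phi1 phi2 g' ->
  forall t : R, t \in `]0, T[ -> dx 0 a e2 0 t = - dx (- a) 0 e1 0 t.
Proof.
move=> st t tI.
have ce1 := dx_cvg (zhs_classical (nnwr_e1 st)) hi_in tI.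
have ce2 := reflect_dx_cvg (nnwr_e2 st) tI.
(* Uniqueness of limits needs [0] to be an accumulation point of [[- a, 0]]; the points [- h] show
   it. *)
have PF : ProperFilter (within `[- a, 0] (0 : R)^').
  split; last exact: within_filter.
  rewrite /within /= => -[e /= e0 He].
  pose h := Num.min (e / 2) a.
  have h0 : 0 < h by rewrite lt_min a_gt0 divr_gt0.
  have hb : h <= a by rewrite ge_min lexx orbT.
  have he : h <= e / 2 by rewrite ge_min lexx.
  apply: (He (- h)).
  - by rewrite /= opprK add0r gtr0_norm//; lra.
  - by rewrite oppr_eq0 gt_eqF.
  - by rewrite in_itv /=; lra.
apply/eqP; rewrite -eqr_opp opprK; apply/eqP.
apply: (cvg_unique _ ce2) => //.
apply: cvg_trans ce1; apply: near_eq_cvg.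
rewrite near_withinE; apply: nearW => y yI.
have tI' : t \in `[- tau, T] by move: tI tau_gt0; rewrite !in_itv /=; lra.
by rewrite /diff_quot !(nnwr_step_reflect_e2 st _ tI').
Qed.

(* The Neumann data of [phi1] and of the reflected [phi2] are twice the flux of
   [e1], so both Neumann solutions are [2 e1]. *)
Lemma nnwr_step_phi g e1 e2 phi1 phi2 g' : step g e1 e2 phi1 phi2 g' ->
  forall t : R, t \in `[- tau, T] ->
  phi1 0 t = 2 * e1 0 t /\ phi2 0 t = 2 * e1 0 t.
Proof.
move=> st t tI.
have s1 := zero_history_interior_solution (nnwr_e1 st).
have sp1 := zero_history_interior_solution (nnwr_phi1 st).
have sp2 := reflect_solution (nnwr_phi2 st).
(* The difference [phi - 2 * e1] vanishes at [- a] and has zero flux at [0], so uniqueness applies;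
   [phi] is either [phi1] or the reflected [phi2]. *)
have main (phi : R -> R -> R) : sol phi ->
    (forall s : R, s \in `]0, T[ -> phi (- a) s = 0) ->
    (forall s : R, s \in `]0, T[ ->
      diff_quot phi 0 s @ within `[- a, 0] 0^' --> 2 * dx (- a) 0 e1 0 s) ->
    phi 0 t = 2 * e1 0 t.
  move=> sp out dphi.
  have sw := interior_solution_lincomb tau_gt0 1 (-2) sp s1.
  have := interior_solution_eq0 tau_gt0 T_gt0 lo_lt_hi sw _ _ hi_in tI.
  rewrite mul1r mulNr => H; apply/eqP; rewrite -subr_eq0; apply/eqP; apply: H.
    by move=> s sI; rewrite out//; case: (nnwr_e_outer st sI) => -> _; ring.
  move=> s sI; right.
  have ce1 := dx_cvg (zhs_classical (nnwr_e1 st)) hi_in sI.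
  have := diff_quot_lincomb (p := 1) (q := -2) (dphi s sI) ce1.
  by rewrite mul1r mulNr subrr; apply.
have flux (s : R) : s \in `]0, T[ ->
    2 * dx (- a) 0 e1 0 s = dx (- a) 0 e1 0 s - dx 0 a e2 0 s.
  by move=> sI; rewrite (nnwr_step_dx_e2 st sI); ring.
split.
  apply: main => // s sI; first by case: (nnwr_phi_outer st sI).
  rewrite flux//; case: (nnwr_phi_interface st sI) => <- _.
  exact: dx_cvg (zhs_classical (nnwr_phi1 st)) hi_in sI.
rewrite -[X in phi2 X]oppr0; apply: (main (fun x t => phi2 (- x) t)) => // s sI.
  by rewrite opprK; case: (nnwr_phi_outer st sI).
rewrite flux//; case: (nnwr_phi_interface st sI) => _ <-.
exact: reflect_dx_cvg (nnwr_phi2 st) sI.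
Qed.

(** Each Neumann trace is [2 * e1 0 t], so the correction is [4 * theta * g t]; continuity supplies
    the interface condition at times [0] and [T]. *)
Lemma nnwr_step_interface g e1 e2 phi1 phi2 g' : step g e1 e2 phi1 phi2 g' ->
  {within `[0, T], continuous g} ->
  forall t : R, t \in `[0, T] -> g' t = (1 - 4 * theta) * g t.
Proof.
move=> st cg t tI; rewrite (nnwr_update st tI).
have tI' : t \in `[- tau, T] by move: tI tau_gt0; rewrite !in_itv /=; lra.
have [-> ->] := nnwr_step_phi st tI'.
suff -> : e1 0 t = g t by ring.
apply: (itvcc_eq_of_itvoo T_gt0 _ cg _ tI).
  apply: (@continuous_subspaceW _ _ _ `[- tau, T]).
    by move=> s /=; move: tau_gt0; rewrite !in_itv /=; lra.
  apply: continuous_slice2 hi_in.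
  exact: isol_cont (zero_history_interior_solution (nnwr_e1 st)).
by move=> s sI; case: (nnwr_e_interface st sI).
Qed.

Lemma nnwr_iterates_interface g0 e1 e2 phi1 phi2 g :
  {within `[0, T], continuous g0} ->
  nnwr_iterates tau mu c r d T a a theta g0 e1 e2 phi1 phi2 g ->
  forall (k : nat) (t : R), t \in `[0, T] -> g k t = (1 - 4 * theta) ^+ k * g0 t.
Proof.
move=> cg0 [g00 st] k.
elim: k => [|k IH] t tI; first by rewrite expr0 mul1r g00.
rewrite exprS -mulrA -IH//; apply: (nnwr_step_interface (st k)) => //.
(* Continuity of [g k] on [[0, T]] comes from the induction hypothesis, as [g k] is a multiple of
   [g0] there. *)
apply/subspace_continuousP => s sI.
have ck : (1 - 4 * theta) ^+ k * g0 u @[u --> within `[0, T] (nbhs s)] --> g k s.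
  rewrite IH//; apply: cvgM; first exact: cvg_cst.
  by move/subspace_continuousP: cg0; exact.
apply: cvg_trans ck; apply: near_eq_cvg.
by rewrite near_withinE; apply: nearW => u uI; rewrite /from_subspace IH.
Qed.

End EqualSubdomains.

(** * Sup norms of continuous functions and their multiples *)

(** By continuity [|f|] attains its maximum at some [t0]. Both suprema are then values at [t0],
    obtained from one claim with factors [|q|] and [1]. *)
Lemma supnorm_scale (R : realType) (T q : R) (f g : R -> R) :
  0 < T -> {within `[0, T], continuous f} ->
  (forall t : R, t \in `[0, T] -> g t = q * f t) ->
  supnorm T g = `|q| * supnorm T f.
Proof.
move=> T0 cf gf.
have cn : {within `[0, T], continuous (fun t => `|f t|)}.
  apply/subspace_continuousP => t tI; apply: cvg_norm.
  by move/subspace_continuousP: cf; exact.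
have [t0 t0I max] := EVT_max (ltW T0) cn.
have sup_of (h : R -> R) (p : R) : 0 <= p ->
    (forall t : R, t \in `[0, T] -> `|h t| = p * `|f t|) -> supnorm T h = p * `|f t0|.
  move=> p0 hf; apply/eqP; rewrite eq_le; apply/andP; split.
    apply: ge_sup; first by exists `|h t0|, t0.
    by move=> _ [t tI <-]; rewrite hf// ler_wpM2l// max.
  rewrite -hf//; apply: ub_le_sup; last by exists t0.
  by exists (p * `|f t0|) => _ [t tI <-]; rewrite hf// ler_wpM2l// max.
rewrite (sup_of g `|q|)//; last by move=> t tI; rewrite gf// normrM.
by rewrite (sup_of f 1)// ?mul1r// => t tI; rewrite mul1r.
Qed.

(** Continuity bounds the set of values, so [sup] is a genuine supremum and not its default
    value. *)
Lemma supnorm_gt0 (R : realType) (T : R) (f : R -> R) :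
  0 < T -> {within `[0, T], continuous f} -> not_identically_zero T f ->
  0 < supnorm T f.
Proof.
move=> T0 cf [t tI ft].
have cn : {within `[0, T], continuous (fun t => `|f t|)}.
  apply/subspace_continuousP => s sI; apply: cvg_norm.
  by move/subspace_continuousP: cf; exact.
have [t0 t0I max] := EVT_max (ltW T0) cn.
apply: (@lt_le_trans _ _ `|f t|); first by rewrite normr_gt0.
apply: ub_le_sup; last by exists t.
by exists `|f t0| => _ [s sI <-]; exact: max.
Qed.

(** * Linear convergence and termination after two iterations *)

Theorem theorem6 (R : realType) (tau mu c r d T a b theta : R)
    (tau_gt0 : 0 < tau) (mu_gt0 : 0 < mu) (T_gt0 : 0 < T)
    (a_gt0 : 0 < a) (b_gt0 : 0 < b) (eq_ab : a = b) :
  (0 < theta < 1 / 2 -> theta != 1 / 4 ->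
     converges_linearly tau mu c r d T a b theta) /\
  (theta = 1 / 4 ->
     converges_in_two_iterations tau mu c r d T a b theta).
Proof.
subst b; split=> [thetaI theta4 g0 [cg0 _] g0n|theta4 g0 [cg0 _] e1 e2 phi1 phi2 g it].
  have q0 : 1 - 4 * theta != 0.
    by apply: contra theta4 => /eqP q0; apply/eqP; lra.
  (* For [0 < theta < 1 / 2] the factor lies strictly between -1 and 1, and it vanishes only at
     [theta = 1 / 4]. *)
  exists `|1 - 4 * theta|.
    by rewrite normr_gt0 q0 /= ltr_norml; lra.
  move=> e1 e2 phi1 phi2 g it.
  have gE := nnwr_iterates_interface tau_gt0 T_gt0 a_gt0 cg0 it.
  split=> [k|].
    case: g0n => t tI g0t; exists t => //.
    by rewrite gE// mulf_neq0// expf_neq0.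
  (* The ratio is the same for every [k], so its limit is immediate. *)
  have sE (k : nat) : supnorm T (g k.+1) / supnorm T (g k) = `|1 - 4 * theta|.
    rewrite !(supnorm_scale T_gt0 cg0 (gE _)) !normrX exprS -mulrA mulfK//.
    by rewrite mulf_neq0 ?expf_neq0 ?normr_eq0// gt_eqF// supnorm_gt0.
  by under eq_fun do rewrite sE; exact: cvg_cst.
have g_eq0 (k : nat) (t : R) : t \in `[0, T] -> g k.+1 t = 0.
  move=> tI; rewrite (nnwr_iterates_interface tau_gt0 T_gt0 a_gt0 cg0 it)// exprS.
  by rewrite theta4 [_ - _](_ : _ = 0) ?mul0r//; field.
(* The errors [e1 k.+2] and [e2 k.+2] are driven by [g k.+1], which is already zero; hence vanishing
   starts at the second iteration. *)
move=> [//|[//|k]] _; case: it => _ /(_ k.+1) st.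
have [|e10 e20] := nnwr_step_eq0 tau_gt0 T_gt0 a_gt0 st; last by split=> // t; exact: g_eq0.
by move=> t tI; apply: g_eq0; move: tI; rewrite !in_itv /=; lra.
Qed.
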